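(* Let $0<t_1<t_2<d$ and $\varepsilon>0$. Then there exists a perfectly balanced NCIFS $\Phi$ on a set $X\subset\mathbb R^d$ with \[\limsup_{j\to\infty}\frac1j\log\# I^{(j)}\le\varepsilon\] such that $\operatorname{HD}(J(\Phi))=t_1$ and $B(\Phi)=t_2$.
   Context: Here $X\subset\mathbb R^d$ is a compact set equal to the closure of its interior, with $\partial X$ smooth or $X$ convex (for example a cube). $\|D\phi\|:=\sup_{x\in X}|\phi'(x)|$ for a conformal map $\phi$. An NCIFS $\Phi$ on $X$ is a sequence $\Phi^{(j)}=(\phi^{(j)}_i:X\to X)_{i\in I^{(j)}}$, $j\ge1$, of families indexed by finite or countably infinite sets, satisfying: - (open set condition) images of $\operatorname{int}X$ under distinct maps of the same $\Phi^{(j)}$ are disjoint; - (conformality) there is an open connected $V\supset X$ such that all maps extend to $C^1$ conformal diffeomorphisms of $V$ into $V$; - (bounded distortion) there is $K\ge1$ with $|\phi'(x)|\le K|\phi'(y)|$ for $x,y\in V$ and every composition $\phi^{(k)}_{\omega_k}\circ\cdots\circ\phi^{(l)}_{\omega_l}$; - (uniform contraction) $\|D\phi^{(j)}_i\|\le\eta<1$ for all $i,j$. $\Phi$ is perfectly balanced if all maps $\phi^{(n)}_i$ are affine similarities and, for each $n$, all maps in $\Phi^{(n)}$ have the same contraction ratio. For $\omega\in I^n=\prod_{j\le n}I^{(j)}$ let $\phi_\omega=\phi^{(1)}_{\omega_1}\circ\cdots\circ\phi^{(n)}_{\omega_n}$. Define $J(\Phi)=\bigcap_n\bigcup_{\omega\in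 I^n}\phi_\omega(X)$, $Z_n(t)=\sum_{\omega\in I^n}\|D\phi_\omega\|^t$, $\underline P(t)=\liminf_n\frac1n\log Z_n(t)$ and $B(\Phi)=\sup\{t\ge0:\underline P(t)>0\}$. $\operatorname{HD}$ is Hausdorff dimension. *)

(* Defs.v *)
From HB Require Import structures.
From mathcomp Require Import all_boot all_order all_algebra.
From mathcomp Require Import all_classical all_reals all_analysis.
From mathcomp Require Import finmap.
Set Implicit Arguments. Unset Strict Implicit. Unset Printing Implicit Defensive.
Import Order.TTheory GRing.Theory Num.Theory.
Import numFieldNormedType.Exports.
Local Open Scope classical_set_scope.
Local Open Scope ring_scope.

Section NCIFS.
Variables (R : realType) (d : nat).
Local Notation V := 'rV[R]_d.

Definition enorm (v : V) : R := Num.sqrt (\sum_(i < d) v 0 i ^+ 2).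
Definition edist (x y : V) : R := enorm (x - y).

Definition dnorm (f : V -> V) (x : V) : R :=
  sup [set enorm ('d f x v) | v in [set v : V | enorm v = 1]].

Definition normD (X : set V) (f : V -> V) : R := sup [set dnorm f x | x in X].

Definition boundary (X : set V) : set V := closure X `\` interior X.

Fixpoint Cn (n : nat) (U : set V) (g : V -> R^o) : Prop :=
  match n with
  | 0 => forall x, U x -> {for x, continuous g}
  | n.+1 => (forall x, U x -> differentiable g x) /\
            forall v : V, Cn n U (fun x => 'd g x v)
  end.
Definition smooth_on (U : set V) (g : V -> R^o) : Prop := forall n, Cn n U g.

Definition smooth_boundary (X : set V) : Prop :=
  forall p, boundary X p ->
    exists (U : set V) (g : V -> R^o),
      [/\ open U, U p, smooth_on U g,
          (forall x, U x -> exists v : V, 'd g x v != 0) &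
          X `&` U = [set x | U x /\ g x <= 0]].

Definition admissible_X (X : set V) : Prop :=
  [/\ compact X, X = closure (interior X) & (smooth_boundary X \/ convex_set X)].

(* Levels are 0-based: level j here is the paper's Phi^(j+1). *)
Definition valid_from (I : nat -> set nat) (k : nat) (w : seq nat) : Prop :=
  forall m, (m < size w)%N -> I (k + m)%N (nth 0%N w m).

Definition words (I : nat -> set nat) (n : nat) : set (seq nat) :=
  [set w | size w = n /\ valid_from I 0 w].

Fixpoint compw (phi : nat -> nat -> V -> V) (k : nat) (w : seq nat) : V -> V :=
  match w with
  | [::] => id
  | i :: w' => phi k i \o compw phi k.+1 w'
  end.

Definition C1_on (U : set V) (f : V -> V) : Prop :=
  (forall x, U x -> differentiable f x) /\
  forall v : V, forall x, U x -> {for x, continuous (fun y => 'd f y v)}.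

Definition conformal_diffeo_into (U : set V) (f : V -> V) : Prop :=
  [/\ C1_on U f,
      f @` U `<=` U,
      (forall x, U x -> exists2 c : R, 0 < c & forall v, enorm ('d f x v) = c * enorm v),
      open (f @` U) &
      exists g : V -> V, (forall x, U x -> g (f x) = x) /\ C1_on (f @` U) g].

Definition NCIFS (X : set V) (I : nat -> set nat) (phi : nat -> nat -> V -> V) : Prop :=
  [/\
      (forall j i, I j i -> phi j i @` X `<=` X),
      (forall j i1 i2, I j i1 -> I j i2 -> i1 <> i2 ->
          phi j i1 @` interior X `&` phi j i2 @` interior X = set0),
      (exists U : set V, [/\ open U, connected U, X `<=` U &
          forall j i, I j i -> conformal_diffeo_into U (phi j i)] /\
       exists2 K : R, 1 <= K &
         forall k w, valid_from I k w -> w <> [::] ->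
         forall x y, U x -> U y ->
           dnorm (compw phi k w) x <= K * dnorm (compw phi k w) y) &
      exists2 eta : R, eta < 1 & forall j i, I j i -> normD X (phi j i) <= eta].

Definition perfectly_balanced (X : set V) (I : nat -> set nat)
    (phi : nat -> nat -> V -> V) : Prop :=
  forall j, exists2 r : R, 0 < r &
    forall i, I j i -> exists (A : 'M[R]_d) (b : V),
      A *m A^T = 1%:M /\ forall x, X x -> phi j i x = r *: (x *m A) + b.

Definition limit_set (X : set V) (I : nat -> set nat) (phi : nat -> nat -> V -> V)
  : set V := \bigcap_n \bigcup_(w in words I n) (compw phi 0 w @` X).

Definition elog (z : \bar R) : \bar R :=
  match z with
  | r%:E => if 0 < r then (ln r)%:E else -oo%E
  | +oo%E => +oo%E
  | -oo%E => -oo%E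
  end.

Definition Zn (X : set V) (I : nat -> set nat) (phi : nat -> nat -> V -> V)
  (n : nat) (t : R) : \bar R :=
  \esum_(w in words I n) ((normD X (compw phi 0 w)) `^ t)%:E.

Definition lower_pressure (X : set V) (I : nat -> set nat)
  (phi : nat -> nat -> V -> V) (t : R) : \bar R :=
  limn_einf (fun n => ((n.+1%:R)^-1)%:E * elog (Zn X I phi n.+1 t))%E.

Definition Bphi (X : set V) (I : nat -> set nat) (phi : nat -> nat -> V -> V)
  : \bar R :=
  ereal_sup [set t%:E | t in [set t : R | 0 <= t /\ (0 < lower_pressure X I phi t)%E]].

Definition ecard (A : set nat) : \bar R :=
  if pselect (finite_set A) then ((#|` fset_set A|)%fset%:R)%:E else +oo%E.

Definition diam (U : set V) : R :=
  sup [set r | exists x y, [/\ U x, U y & r = edist x y]].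

Definition Hcost (s : R) (U : set V) : \bar R :=
  if pselect (U = set0) then 0%E else ((diam U) `^ s)%:E.

Definition Hdelta (s delta : R) (A : set V) : \bar R :=
  ereal_inf [set (\sum_(0 <= n <oo) Hcost s (U n))%E |
    U in [set U : nat -> set V | A `<=` \bigcup_n U n /\
          forall n x y, U n x -> U n y -> edist x y <= delta]].

Definition Hmeasure (s : R) (A : set V) : \bar R :=
  ereal_sup [set Hdelta s delta A | delta in [set delta : R | 0 < delta]].

Definition HD (A : set V) : \bar R :=
  ereal_inf [set s%:E | s in [set s : R | 0 <= s /\ Hmeasure s A = 0%E]].

End NCIFS.
Arguments ecard {R}.

(* Main.v *)
Require Import Defs.
From HB Require Import structures.
From mathcomp Require Import all_boot all_order all_algebra.
From mathcomp Require Import all_classical all_reals all_analysis.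
From mathcomp Require Import finmap zify ring lra.
Import Order.TTheory GRing.Theory Num.Theory.
Import numFieldNormedType.Exports.
Local Open Scope classical_set_scope.
Local Open Scope ring_scope.

(** Level [j] maps the unit cube onto [m j ^ d] cubes of side [r j] clustered on
    a grid of mesh [2 * r j].  Put [M_n = m 0 ... m (n-1)] and
    [rho_n = r 0 ... r (n-1)].  Then [Z_n(t) = M_n ^ d * rho_n ^ t], whereas the
    limit set is covered by [M_n ^ d] cubes of side about [m n * rho_(n+1)], each
    of them holding a whole cluster; the dimension of the limit set is [d] times
    the liminf of [log M_n / - log (m n * rho_(n+1))].

    For the lower bound on the dimension, the mixed-radix rank of a word is, in
    each coordinate, a Hoelder function of the corner of its cube.  A set of
    diameter [D] therefore contains the corners of at most a multiple of
    [M_n ^ d * D ^ t] of the [M_n ^ d] words of length [n], so after reduction to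
    a finite open cover by compactness the costs of a cover sum up to a positive
    constant.

    The two exponents separate when [m n] is exponentially large at sparse levels.
    Take [log_2 m j = S (j+1) - S j] and [- log_2 (r j) = kap + bet * log_2 m j],
    where [S] is constant except that it is multiplied by [g] on entering each
    level [n] with [n = q * g * S (n-1)].  The worst levels for the pressure are
    those just before a jump, which gives [d / t2 = kap * q * g + bet], and the
    worst ones for the dimension are the jumps, which gives
    [d / t1 = kap * q * g + (bet - 1) * g + 1].  The number [q] controls the
    growth of the alphabets. *)

(** * Homotheties with translation: derivatives, norms, conformality *)

Lemma affine_is_diff (R : realType) (d : nat) (c : R) (b x : 'rV[R]_d) :
  is_diff x (fun y => c *: y + b) ( *:%R c).
Proof.
have h : is_diff x (( *:%R c) + cst b) (( *:%R c) + 0 : 'rV[R]_d -> 'rV[R]_d).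
  exact: is_diffD.
apply: is_diff_eq h _.
by apply/funext => y; rewrite fctE /= addr0.
Qed.

Lemma affine_diffE (R : realType) (d : nat) (c : R) (b x v : 'rV[R]_d) :
  'd (fun y => c *: y + b) x v = c *: v.
Proof. by have h := affine_is_diff R d c b x; rewrite diff_val. Qed.

Lemma enormZ (R : realType) (d : nat) (c : R) (v : 'rV[R]_d) :
  0 <= c -> enorm (c *: v) = c * enorm v.
Proof.
move=> c0; rewrite /enorm.
under eq_bigr do rewrite mxE exprMn.
by rewrite -mulr_sumr sqrtrM ?sqr_ge0// sqrtr_sqr ger0_norm.
Qed.

Lemma enorm_delta (R : realType) (d : nat) (i : 'I_d) :
  enorm (delta_mx 0 i : 'rV[R]_d) = 1.
Proof.
rewrite /enorm (bigD1 i)//= mxE !eqxx/= big1 ?addr0 ?expr1n ?sqrtr1//.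
by move=> j /negbTE ji; rewrite mxE eqxx ji /= expr0n.
Qed.

Lemma coord_le_edist (R : realType) (d : nat) (x y : 'rV[R]_d) i :
  `|x 0 i - y 0 i| <= Defs.edist x y.
Proof.
rewrite /Defs.edist /enorm -sqrtr_sqr ler_sqrt ?sqr_ge0//; last first.
  by apply: sumr_ge0 => j _; rewrite sqr_ge0.
rewrite (bigD1 i)//= !mxE lerDl; apply: sumr_ge0 => j _; exact: sqr_ge0.
Qed.

Lemma edist_le_coord (R : realType) (d : nat) (x y : 'rV[R]_d) (l : R) :
  0 <= l -> (forall i, `|x 0 i - y 0 i| <= l) -> Defs.edist x y <= d%:R * l.
Proof.
move=> l0 h; rewrite /Defs.edist /enorm.
rewrite -[leRHS]ger0_norm ?mulr_ge0// -sqrtr_sqr.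
apply: ler_wsqrtr.
apply: (@le_trans _ _ (\sum_(i < d) l ^+ 2)).
  apply: ler_sum => i _; rewrite !mxE -real_normK ?num_real//.
  by rewrite lerXn2r ?nnegrE.
rewrite sumr_const card_ord -[leLHS]mulr_natl exprMn ler_wpM2r ?sqr_ge0//.
by rewrite -natrX ler_nat; case: (d) => // n; rewrite -mulnn leq_pmulr.
Qed.

Lemma dnorm_affine (R : realType) (d : nat) (c : R) (b x : 'rV[R]_d) :
  (0 < d)%N -> 0 <= c -> dnorm (fun y => c *: y + b) x = c.
Proof.
move=> d0 c0; rewrite /dnorm.
rewrite (_ : [set _ | _ in _] = [set c]) ?sup1//.
apply/seteqP; split => [_ [v /= v1 <-]|_ /= ->].
  by rewrite affine_diffE enormZ// v1 mulr1.
exists (delta_mx 0 (Ordinal d0)); first exact: enorm_delta.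
by rewrite affine_diffE enormZ// enorm_delta mulr1.
Qed.

Lemma normD_affine (R : realType) (d : nat) (X : set 'rV[R]_d) (c : R)
    (b : 'rV[R]_d) :
  (0 < d)%N -> 0 <= c -> X !=set0 -> normD X (fun y => c *: y + b) = c.
Proof.
move=> d0 c0 [x Xx]; rewrite /normD.
rewrite (_ : [set _ | _ in _] = [set c]) ?sup1//.
apply/seteqP; split => [_ [y _ <-]|_ /= ->].
  by rewrite dnorm_affine.
by exists x; rewrite ?dnorm_affine.
Qed.

Lemma affine_C1_on (R : realType) (d : nat) (U : set 'rV[R]_d) (c : R)
  (b : 'rV[R]_d) : C1_on U (fun y => c *: y + b).
Proof.
split => [x _|v x _]; first by have h := affine_is_diff R d c b x.
rewrite (_ : (fun y => _) = cst (c *: v)); first exact: cst_continuous.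
by apply/funext => y; rewrite affine_diffE.
Qed.

Lemma affine_conformal (R : realType) (d : nat) (c : R) (b : 'rV[R]_d) :
  0 < c -> conformal_diffeo_into setT (fun y => c *: y + b).
Proof.
move=> c0.
have im : (fun y => c *: y + b) @` setT = setT.
  apply/seteqP; split => // y _; exists (c^-1 *: (y - b)) => //.
  by rewrite scalerA mulfV ?gt_eqF// scale1r subrK.
split => //.
- exact: affine_C1_on.
- move=> x _; exists c => // v.
  by rewrite affine_diffE enormZ// ltW.
- by rewrite im; exact: openT.
- exists (fun y => c^-1 *: y + - (c^-1 *: b)); split.
    move=> x _; rewrite scalerDr scalerA mulVf ?gt_eqF// scale1r.
    by rewrite addrK.
  exact: affine_C1_on.
Qed.

(** * The unit cube and the ambient space *)

Definition cube (R : realType) (d : nat) : set 'rV[R]_d :=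
  closed_ball (const_mx 2^-1 : 'rV[R]_d) 2^-1.

(** The norm of row vectors is the sup norm, so its closed balls are cubes; writing the cube as a
    ball gives access to the known interior and closure of balls. *)
Lemma cubeP (R : realType) (d : nat) (x : 'rV[R]_d) :
  cube R d x <-> forall i, 0 <= x 0 i <= 1.
Proof.
rewrite /cube closed_ballE ?invr_gt0// /closed_ball_ /=; split => h.
  move=> i; have : `|(const_mx 2^-1 - x : 'rV[R]_d) 0 i| <= 2^-1.
    by apply: le_trans h; rewrite [leRHS]mx_normrE; exact: (le_bigmax _ _ (0, i)).
  by rewrite !mxE ler_norml => /andP[] *; apply/andP; split; lra.
rewrite [leLHS]mx_normrE; apply/bigmax_leP; split; first by rewrite invr_ge0.
move=> [i j] _ /=; rewrite !mxE (ord1 i) ler_norml.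
by have /andP[] := h j => *; apply/andP; split; lra.
Qed.

Lemma interior_cubeP (R : realType) (d : nat) (x : 'rV[R]_d) i :
  interior (cube R d) x -> 0 < x 0 i < 1.
Proof.
rewrite /cube interior_closed_ballE ?invr_gt0//.
move=> [_ /(_ 0 i)]; rewrite /ball /= !mxE ltr_norml => /andP[] *.
by apply/andP; split; lra.
Qed.

Lemma cube_compact (R : realType) (d : nat) : compact (cube R d).
Proof.
have -> : cube R d = [set v : 'rV[R]_d | forall i, `[(0:R), 1]%classic (v ord0 i)].
  apply/seteqP; split => x /=; rewrite cubeP => h i; have := h i;
  by rewrite ?in_itv/=.
have := @rV_compact R d (fun=> `[(0:R), 1]%classic).
by apply => i; exact: segment_compact.
Qed.

Lemma cube_admissible (R : realType) (d : nat) : admissible_X (cube R d).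
Proof.
split; first exact: cube_compact.
  by rewrite {2}/cube interior_closed_ballE ?invr_gt0.
right => x y l /set_mem/cubeP hx /set_mem/cubeP hy; apply/mem_set/cubeP => i.
have -> : conv l x y 0 i = l%:num * x 0 i + (1 - l%:num) * y 0 i.
  rewrite -[conv l x y]/(l%:num *: (x : 'rV[R]_d)
    + (1 - l%:num) *: (y : 'rV[R]_d)).
  by rewrite !mxE.
have /andP[x0 x1] := hx i; have /andP[y0 y1] := hy i.
have l0 : 0 <= l%:num by []; have l1 : l%:num <= 1 by [].
by apply/andP; split; nra.
Qed.

(** The space is the union of its lines through the origin. *)
Lemma connected_setT_lmod (R : realType) (V : normedModType R) :
  connected [set: V].
Proof.
have -> : [set: V] = \bigcup_(v in [set: V]) (( *:%R ^~ v) @` [set: R]).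
  by apply/seteqP; split => // v _; exists v => //; exists 1; rewrite ?scale1r.
apply: bigcup_connected; first by exists 0 => v _; exists 0; rewrite ?scale0r.
move=> v _; apply: connected_continuous_connected.
  by apply/connected_intervalP => x y _ _ z.
by apply: continuous_subspaceT => x; exact: scalel_continuous.
Qed.

(** * Counting, diameters and covering costs *)

Lemma size_le_sum_count (T : eqType) (l : seq T) N (P : 'I_N -> pred T) :
  (forall x, x \in l -> exists i, P i x) ->
  (size l <= \sum_(i < N) count (P i) l)%N.
Proof.
elim: l => //= x l IH h; rewrite big_split/= -addn1 addnC leq_add//.
  have [i Pix] := h x (mem_head _ _).
  by rewrite (bigD1 i)//= Pix leq_addr.
by apply: IH => y yl; apply: h; rewrite inE yl orbT.
Qed.

Lemma sum_half_pow (R : realFieldType) N :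
  \sum_(i < N) (2^-1 : R) ^+ i.+1 = 1 - 2^-1 ^+ N.
Proof.
elim: N => [|N IH]; first by rewrite big_ord0 expr0 subrr.
by rewrite big_ord_recr /= IH exprS; field.
Qed.

Lemma diam_ge (R : realType) (d : nat) (U : set 'rV[R]_d) (D : R) x y :
  (forall x y, U x -> U y -> Defs.edist x y <= D) -> U x -> U y ->
  Defs.edist x y <= diam U.
Proof.
move=> UD Ux Uy; apply: ub_le_sup; last by exists x, y.
by exists D => _ [a [b [Ua Ub ->]]]; exact: UD.
Qed.

Lemma diam_le (R : realType) (d : nat) (U : set 'rV[R]_d) (D : R) :
  0 <= D -> (forall x y, U x -> U y -> Defs.edist x y <= D) -> diam U <= D.
Proof.
move=> D0 UD; rewrite /diam; have [->|/set0P ne] := eqVneq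
    [set e | exists x y, [/\ U x, U y & e = Defs.edist x y]] set0.
  by rewrite sup0.
by apply: ge_sup => // _ [a [b [Ua Ub ->]]]; exact: UD.
Qed.

Lemma enorm_ge0 (R : realType) (d : nat) (v : 'rV[R]_d) : 0 <= enorm v.
Proof. exact: sqrtr_ge0. Qed.

Lemma diam_ge0 (R : realType) (d : nat) (U : set 'rV[R]_d) : 0 <= diam U.
Proof.
rewrite /diam; set E := [set _ | _].
have [ubE|nubE] := pselect (has_ubound E); last first.
  by rewrite sup_out// => -[].
have [->|/set0P [e Ee]] := eqVneq E set0; first by rewrite sup0.
apply: (@le_trans _ _ e); last exact: ub_le_sup.
by case: Ee => x [y [_ _ ->]]; exact: enorm_ge0.
Qed.

Lemma Hcost_ge0 (R : realType) (d : nat) (s : R) (U : set 'rV[R]_d) :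
  (0 <= Hcost s U)%E.
Proof. by rewrite /Hcost; case: pselect => U0 //; rewrite lee_fin powR_ge0. Qed.

(** Powers of a number in []0, 1]] decrease in the exponent. The empty set costs 0 and has diameter
    [sup set0 = 0], which is harmless because [t] is positive. *)
Lemma le_Hcost (R : realType) (d : nat) (s t : R) (U : set 'rV[R]_d) :
  s <= t -> 0 < t -> diam U <= 1 -> ((diam U `^ t)%:E <= Hcost s U)%E.
Proof.
move=> st t0 U1; rewrite /Hcost; case: pselect => [U0|U0] /=.
  rewrite /diam (_ : [set _ | _] = set0) ?sup0 ?powR0 ?gt_eqF//.
  by rewrite -subset0 U0 => e [x [y []]].
have := diam_ge0 _ _ U; rewrite le_eqVlt => /predU1P[<-|D0].
  by rewrite powR0 ?gt_eqF// lee_fin powR_ge0.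
by rewrite lee_fin ger_powR// D0.
Qed.

(** * Grid systems: coding by digits and composition of maps *)

Section GridSystem.
Variables (R : realType) (d : nat) (m : nat -> nat) (r : nat -> R).

Definition digit j i c : nat := ((i %/ m j ^ c) %% m j)%N.

Definition grid_alphabet j : set nat := [set i | (i < m j ^ d)%N].

(* Neighbouring grid cells are [2 * r j] apart, so a gap of length [r j] separates
   their images in every coordinate direction. *)
Definition grid_map j i (x : 'rV[R]_d) : 'rV[R]_d :=
  r j *: x + \row_c (2 * r j * (digit j i c)%:R).

(** This is [M_n], the count along one coordinate axis; there are [branchings n ^ d] words of length
    [n]. *)
Definition branchings n : nat := (\prod_(j < n) m j)%N.

Definition ratio n : R := \prod_(j < n) r j.

(** The corner with least coordinates of the cube coded by [w], and the translation part of the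
    composed map. *)
Definition offset k w : 'rV[R]_d := compw grid_map k w 0.

Fixpoint rank c k w : nat :=
  if w is i :: w' then
    (digit k i c * \prod_(j < size w') m (k.+1 + j) + rank c k.+1 w')%N
  else 0%N.

(** A duplicate-free enumeration of the words, which turns sums and counts over words into finite
    ones. *)
Fixpoint word_list k n : seq (seq nat) :=
  if n is n'.+1 then
    [seq i :: w | i <- iota 0 (m k ^ d), w <- word_list k.+1 n']
  else [:: [::]].

Hypothesis m_gt0 : forall j, (0 < m j)%N.
Hypothesis r_gt0 : forall j, 0 < r j.

Lemma branchings_gt0 n : (0 < branchings n)%N.
Proof. by apply: prodn_gt0 => i. Qed.

Lemma ratio_gt0 n : 0 < ratio n.
Proof. exact: prodr_gt0. Qed.

Lemma digit_lt j i c : (digit j i c < m j)%N.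
Proof. by rewrite ltn_mod. Qed.

(** Uniqueness of the expansion in base [m j], by induction on the number of digits: the last digit
    is split off by Euclidean division. *)
Lemma digit_inj j i i' : (i < m j ^ d)%N -> (i' < m j ^ d)%N ->
  (forall c, (c < d)%N -> digit j i c = digit j i' c) -> i = i'.
Proof.
rewrite /digit; elim: d i i' => [|n IH] i i'.
  by rewrite expn0 !ltnS !leqn0 => /eqP -> /eqP ->.
rewrite !expnS => hi hi' h.
rewrite (divn_eq i (m j)) (divn_eq i' (m j)).
have := h 0%N isT; rewrite expn0 !divn1 => ->; congr (_ * _ + _)%N.
apply: IH => [||c cn].
- by rewrite ltn_divLR// mulnC.
- by rewrite ltn_divLR// mulnC.
- by have := h c.+1 cn; rewrite expnS !divnMA.
Qed.

Lemma word_listP k n w :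
  reflect (size w = n /\ valid_from grid_alphabet k w) (w \in word_list k n).
Proof.
elim: n k w => [|n IH] k w /=.
  rewrite inE; apply: (iffP eqP) => [->|[/eqP/nilP ->//]].
  by split => // j.
apply: (iffP allpairsP) => [[[i w'] /= [ik /IH [sw' vw'] ->]]|[]].
  split => /=; first by rewrite sw'.
  move=> [_|j /= jw].
    by move: ik; rewrite mem_iota add0n addn0.
  by have := vw' j jw; rewrite addSnnS.
case: w => // i w [sw] v; exists (i, w); split => //=.
  by have := v 0%N isT; rewrite addn0 mem_iota add0n.
apply/IH; split => // j jw.
by have := v j.+1 jw; rewrite addSnnS.
Qed.

Lemma word_list_uniq k n : uniq (word_list k n).
Proof.
elim: n k => [//|n IH] k /=.
apply: allpairs_uniq; rewrite ?iota_uniq//.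
by move=> [i w] [i' w'] _ _ /= [-> ->].
Qed.

Lemma size_word_list k n :
  size (word_list k n) = (\prod_(j < n) m (k + j) ^ d)%N.
Proof.
elim: n k => [|n IH] k /=; first by rewrite big_ord0.
rewrite size_allpairs size_iota IH big_ord_recl addn0; congr (_ * _)%N.
by apply: eq_bigr => j _; rewrite /bump /= addSnnS.
Qed.

Lemma size_word_list0 n : size (word_list 0 n) = (branchings n ^ d)%N.
Proof.
rewrite size_word_list.
by rewrite (big_morph (expn^~ d) (fun a b => expnMn a b d) (exp1n d)).
Qed.

Lemma compw_gridE k w x :
  compw grid_map k w x = (\prod_(j < size w) r (k + j)) *: x + offset k w.
Proof.
rewrite /offset; elim: w k x => [|i w IH] k x /=.
  by rewrite big_ord0 scale1r addr0.
rewrite /= IH /grid_map scalerDr scalerA addrA; congr (_ *: _ + _ + _).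
rewrite big_ord_recl addn0; congr (_ * _).
by apply: eq_bigr => j _; rewrite /bump /= addSnnS.
Qed.

Lemma compw_grid0E w x :
  compw grid_map 0 w x = ratio (size w) *: x + offset 0 w.
Proof. exact: compw_gridE. Qed.

Lemma offset_cons k i w c :
  offset k (i :: w) 0 c = r k * (2 * (digit k i c)%:R + offset k.+1 w 0 c).
Proof. by rewrite /offset /= /grid_map !mxE; ring. Qed.

Lemma compw_cat k w w' x : compw grid_map k (w ++ w') x =
  compw grid_map k w (compw grid_map (k + size w) w' x).
Proof.
elim: w k => [|i w IH] k /=; first by rewrite addn0.
by rewrite IH addSnnS.
Qed.

Lemma offset_zeros k n : offset k (nseq n 0%N) = 0.
Proof.
rewrite /offset; elim: n k => //= n IH k; rewrite IH /grid_map scaler0 add0r.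
by apply/rowP => c; rewrite !mxE /digit div0n mod0n mulr0.
Qed.

Lemma rank_lt c k w : (rank c k w < \prod_(j < size w) m (k + j))%N.
Proof.
elim: w k => [|i w IH] k /=; first by rewrite big_ord0.
rewrite big_ord_recl addn0.
have -> : (\prod_(j < size w) m (k + lift ord0 j) = \prod_(j < size w) m (k.+1 + j))%N.
  by apply: eq_bigr => j _; rewrite /bump /= addSnnS.
have := IH k.+1; have := digit_lt k i c.
move=> digk rk.
apply: (@leq_trans ((digit k i c).+1 * \prod_(j < size w) m (k.+1 + j))%N).
  by rewrite mulSn addnC ltn_add2r.
by apply: leq_mul.
Qed.

(** The rank of the tail is smaller than the weight of the leading digit, so Euclidean division
    recovers the leading digit and the tail rank in every coordinate; [digit_inj] then recovers the
    letter. *)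
Lemma rank_inj k n w w' : w \in word_list k n -> w' \in word_list k n ->
  (forall c, (c < d)%N -> rank c k w = rank c k w') -> w = w'.
Proof.
elim: n k w w' => [|n IH] k w w' /=; first by rewrite !inE => /eqP -> /eqP ->.
move=> /allpairsP[[i u] /= [ik uk ->]] /allpairsP[[i' u'] /= [ik' uk' ->]] /= h.
have [[su _] [su' _]] := (word_listP _ _ _ uk, word_listP _ _ _ uk').
have {}h c : (c < d)%N -> digit k i c = digit k i' c /\ rank c k.+1 u = rank c k.+1 u'.
  move=> cd; have := h c cd; rewrite su su'.
  have := rank_lt c k.+1 u; have := rank_lt c k.+1 u'; rewrite su su'.
  move: (rank _ _ u) (rank _ _ u') (digit k i c) (digit k i' c) => a a' b b'.
  move: (\prod_(j < n) _)%N => T ha' ha e.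
  have T0 : (0 < T)%N by lia.
  have eb : b = b'.
    by move/(congr1 (divn^~ T)): e; rewrite /= !divnMDl// !divn_small// !addn0.
  split; first exact: eb.
  by move: e; rewrite eb; lia.
congr (_ :: _).
  apply: (digit_inj k) => [||c /h[]//]; first by move: ik; rewrite mem_iota.
  by move: ik'; rewrite mem_iota.
by apply: (IH k.+1) => // c /h[].
Qed.

(** Along an axis, [m j] intervals of length [r j] and the [m j - 1] gaps between them have this
    total length. *)
Hypothesis room : forall j, r j * (2 * (m j)%:R - 1) <= 1.

Lemma grid_map_cube j i : grid_map j i @` cube R d `<=` cube R d.
Proof.
move=> _ [x /cubeP hx <-]; apply/cubeP => c; rewrite !mxE.
have /andP[x0 x1] := hx c.
have := room j; have := r_gt0 j.
have : (digit j i c)%:R + 1 <= (m j)%:R :> R.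
  by rewrite natr1 ler_nat digit_lt.
have : 0 <= (digit j i c)%:R :> R by [].
move: (digit j i c)%:R (m j)%:R (r j) => D M q *.
by apply/andP; split; nra.
Qed.

Lemma compw_cube k w : compw grid_map k w @` cube R d `<=` cube R d.
Proof.
elim: w k => [|i w IH] k /=; first by rewrite image_id.
move=> _ [x Xx <-]; apply: (grid_map_cube k i).
by exists (compw grid_map k.+1 w x) => //; apply: IH; exists x.
Qed.

Lemma cube0 : cube R d 0.
Proof. by apply/cubeP => i; rewrite mxE lexx ler01. Qed.

Lemma offset_cube k w : cube R d (offset k w).
Proof. by apply: compw_cube; exists 0 => //; exact: cube0. Qed.

Lemma grid_map_disjoint j i i' : grid_alphabet j i -> grid_alphabet j i' ->
  i <> i' ->
  grid_map j i @` interior (cube R d) `&` grid_map j i' @` interior (cube R d)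
  = set0.
Proof.
move=> hi hi' ne; rewrite -subset0 => _ [[x Xx <-] [y Xy e]]; apply: ne.
apply: digit_inj hi hi' _ => c cd.
have := congr1 (fun z : 'rV[R]_d => z 0 (Ordinal cd)) e; rewrite !mxE /=.
have /andP[x0 x1] := interior_cubeP _ _ _ (Ordinal cd) Xx.
have /andP[y0 y1] := interior_cubeP _ _ _ (Ordinal cd) Xy.
have := r_gt0 j; move: (digit j i c) (digit j i' c) (r j) => a b q q0 {}e.
have {}e : y 0 (Ordinal cd) + 2 * b%:R = x 0 (Ordinal cd) + 2 * a%:R.
  by apply: (mulfI (lt0r_neq0 q0)); lra.
apply/eqP; rewrite eqn_leq; apply/andP; split; rewrite leqNgt; apply/negP => ab;
by have : (1 : R) + b%:R <= a%:R \/ (1 : R) + a%:R <= b%:R;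
  [rewrite !nat1r !ler_nat; tauto | case; lra].
Qed.

Hypothesis d_gt0 : (0 < d)%N.

Lemma grid_perfectly_balanced :
  perfectly_balanced (cube R d) grid_alphabet grid_map.
Proof.
move=> j; exists (r j) => // i _; exists 1%:M.
exists (\row_c (2 * r j * (digit j i c)%:R)); split.
  by rewrite trmx1 mulmx1.
by move=> x _; rewrite mulmx1.
Qed.

Lemma normD_grid_map j i : normD (cube R d) (grid_map j i) = r j.
Proof.
by rewrite normD_affine ?(ltW (r_gt0 _))//; exists 0; exact: cube0.
Qed.

Lemma normD_compw w :
  normD (cube R d) (compw grid_map 0 w) = ratio (size w).
Proof.
rewrite (_ : compw _ _ _ = fun y => ratio (size w) *: y + offset 0 w).
  by rewrite normD_affine ?(ltW (ratio_gt0 _))//; exists 0; exact: cube0.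
by apply/funext => x; rewrite compw_grid0E.
Qed.

Lemma branchingsD k n :
  branchings (k + n) = (branchings k * \prod_(j < n) m (k + j))%N.
Proof. by rewrite /branchings big_split_ord. Qed.

Lemma branchingsS k : branchings k.+1 = (branchings k * m k)%N.
Proof. by rewrite /branchings big_ord_recr. Qed.

Lemma ratioS k : ratio k.+1 = ratio k * r k.
Proof. by rewrite /ratio big_ord_recr. Qed.

(** * Upper bound for the dimension: covering by clusters *)

Section UpperBound.
Variable s : R.
Hypothesis s_gt0 : 0 < s.
Hypothesis thin : forall e, 0 < e ->
  exists n, (branchings n)%:R * ((m n)%:R * ratio n.+1) `^ s < e.

(** One box contains all the cubes of level [n.+1] whose word extends [w]. After a large branching
    with strong contraction it is much smaller than the cube of [w] itself. *)
Definition cluster_box n w : set 'rV[R]_d := [set x | forall c,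
  offset 0 w 0 c <= x 0 c <= offset 0 w 0 c + 2 * ((m n)%:R * ratio n.+1)].

Lemma limit_set_cluster_box n x :
  limit_set (cube R d) grid_alphabet grid_map x ->
  exists2 w, w \in word_list 0 n & cluster_box n w x.
Proof.
move=> /(_ n.+1 I)[w [sw vw]].
have [u [i [wE su]]] : exists u i, w = u ++ [:: i] /\ size u = n.
  case/lastP: w sw {vw} => // u i; rewrite size_rcons => -[<-].
  by exists u, i; rewrite cats1.
move=> [z /cubeP Xz <-]; exists u.
  apply/word_listP; split => // j ju.
  have := vw j; rewrite wE nth_cat ju size_cat su; apply; lia.
move=> c; rewrite wE compw_cat compw_grid0E su /= /grid_map !mxE ratioS.
have /andP[z0 z1] := Xz c.
have : (digit n i c)%:R + 1 <= (m n)%:R :> R.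
  by rewrite natr1 ler_nat digit_lt.
have : 0 <= (digit n i c)%:R :> R by [].
have := r_gt0 n; have := ratio_gt0 n.
move: (digit n i c)%:R (m n)%:R (r n) (ratio n) (offset _ _ _ _) => D M q p o p0 q0 D0 DM.
have pq0 : 0 < p * q by exact: mulr_gt0.
have -> : p * (q * z 0 c + 2 * q * D) + o = o + p * q * (z 0 c + 2 * D) by ring.
apply/andP; split; first by rewrite lerDl mulr_ge0 ?addr_ge0 ?mulr_ge0// ltW.
rewrite lerD2l (_ : 2 * (M * (p * q)) = p * q * (2 * M)); last by ring.
apply: ler_wpM2l; first exact: ltW.
by lra.
Qed.

(** The [M_n ^ d] cluster boxes have diameter at most [2 * d * l], so their total cost is at most
    [K * Q ^ d] with [Q = M_n * l ^ s], and [thin] makes [Q] arbitrarily small. *)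
Lemma Hdelta_limit_set_le delta e : 0 < delta -> 0 < e ->
  (Hdelta (s * d%:R) delta (limit_set (cube R d) grid_alphabet grid_map)
   <= e%:E)%E.
Proof.
move=> delta0 e0.
have dR : 1 <= d%:R :> R by rewrite ler1n.
have d0 : 0 < 2 * d%:R :> R by lra.
set K : R := (2 * d%:R) `^ (s * d%:R).
have K0 : 0 < K by exact: powR_gt0.
(* The three bounds on [Q] serve in turn to keep the diameters below [delta], to get [Q ^ d <= Q],
   and to get [K * Q <= e]. *)
pose e1 := Num.min ((delta / (2 * d%:R)) `^ s) (Num.min 1 (e / K)).
have e1_gt0 : 0 < e1 by rewrite !lt_min powR_gt0 ?divr_gt0// ltr01.
have [n] := thin e1 e1_gt0; set l := _ * ratio n.+1 => Qe1.
have BR : 1 <= (branchings n)%:R :> R by rewrite ler1n branchings_gt0.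
have l0 : 0 <= l by rewrite mulr_ge0 ?(ltW (ratio_gt0 _)).
set Q := _ * l `^ s in Qe1.
have Q0 : 0 <= Q by rewrite mulr_ge0// powR_ge0.
have [Q1 [Q2 Q3]] : Q < (delta / (2 * d%:R)) `^ s /\ Q < 1 /\ Q < e / K.
  by move: Qe1; rewrite /e1 !lt_min => /and3P[].
have l_delta : d%:R * (2 * l) <= delta.
  rewrite leNgt; apply/negP => lt_l'.
  have lt_l : delta / (2 * d%:R) < l by rewrite ltr_pdivrMr//; lra.
  have h : (delta / (2 * d%:R)) `^ s <= l `^ s.
    apply: ge0_ler_powR; rewrite ?nnegrE ?(ltW s_gt0)//; last exact: ltW.
    by rewrite divr_ge0// ltW.
  have : l `^ s <= Q by rewrite ler_peMl// powR_ge0.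
  by move=> /(le_trans h)/le_lt_trans/(_ Q1); rewrite ltxx.
pose W := word_list 0 n.
(* The finite cover is padded by empty sets, which cost nothing, to a sequence. *)
pose U k := if (k < size W)%N then cluster_box n (nth [::] W k) else set0.
have Ul k x y c : U k x -> U k y -> `|x 0 c - y 0 c| <= 2 * l.
  rewrite /U; case: ifP => // _ /(_ c) + /(_ c).
  rewrite -/l ler_norml => /andP[? ?] /andP[? ?].
  by apply/andP; split; lra.
have Ud k x y : U k x -> U k y -> Defs.edist x y <= d%:R * (2 * l).
  by move=> Ux Uy; apply: edist_le_coord => [|c]; [rewrite mulr_ge0 | exact: Ul Ux Uy].
apply: ge_ereal_inf; exists (\sum_(0 <= k <oo) Hcost (s * d%:R) (U k))%E.
  exists U => //; split => [x /(limit_set_cluster_box n)[w wW xw]|k x y Ux Uy].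
    by exists (index w W) => //; rewrite /U index_mem wW nth_index.
  by apply: le_trans l_delta; exact: Ud Ux Uy.
rewrite (nneseries_split 0 (size W)); last by move=> k _; exact: Hcost_ge0.
rewrite eseries0 ?adde0; last first.
  by move=> k kW _; rewrite /U ltnNge add0n in kW *; rewrite kW /Hcost; case: pselect.
rewrite add0n.
apply: (@le_trans _ _ (\sum_(0 <= k < size W) ((d%:R * (2 * l)) `^ (s * d%:R))%:E)%E).
  apply: lee_sum => k _; rewrite /Hcost; case: pselect => U0.
    by rewrite lee_fin powR_ge0.
  have dl0 : 0 <= d%:R * (2 * l) by rewrite mulr_ge0// mulr_ge0.
  rewrite lee_fin; apply: ge0_ler_powR; rewrite ?nnegrE ?diam_ge0//.
    by rewrite mulr_ge0// ltW.
  by apply: diam_le => // x y; exact: Ud.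
rewrite sumEFin big_const_nat subn0 iter_addr_0 size_word_list0 lee_fin.
rewrite -[leLHS]mulr_natl natrX.
have -> : d%:R * (2 * l) = 2 * d%:R * l by ring.
rewrite powRM ?(ltW d0)// -/K mulrCA powRrM powR_mulrn ?powR_ge0// -exprMn -/Q.
apply: (@le_trans _ _ (K * Q)).
  rewrite ler_pM2l// -[leRHS]expr1 ler_wiXn2l//; exact: ltW.
by rewrite mulrC -ler_pdivlMr// ltW.
Qed.

Lemma Hmeasure_limit_set_eq0 :
  Hmeasure (s * d%:R) (limit_set (cube R d) grid_alphabet grid_map) = 0%E.
Proof.
have Hd0 delta : 0 < delta ->
    Hdelta (s * d%:R) delta (limit_set (cube R d) grid_alphabet grid_map) = 0%E.
  move=> delta0; apply/eqP; rewrite eq_le; apply/andP; split.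
    by apply/lee_addgt0Pr => e e0; rewrite add0e; exact: Hdelta_limit_set_le.
  apply: le_ereal_inf_tmp => _ [U _ <-].
  by apply: nneseries_ge0 => k _ _; exact: Hcost_ge0.
rewrite /Hmeasure (_ : [set _ | _ in _] = [set 0%E]) ?ereal_sup1//.
apply/seteqP; split => [_ [delta /= delta0 <-]|_ /= ->]; first exact: Hd0.
by exists 1 => //=; exact: Hd0.
Qed.

End UpperBound.

(** * The axioms of the system and its partition sums *)

Variable eta : R.
Hypothesis r_le_eta : forall j, r j <= eta.
Hypothesis eta_lt1 : eta < 1.

Lemma grid_NCIFS : NCIFS (cube R d) grid_alphabet grid_map.
Proof.
split.
- by move=> j i _; exact: grid_map_cube.
- by move=> j i i' hi hi' /(grid_map_disjoint _ _ _ hi hi').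
- exists setT; split.
    split => //; [exact: openT | | by move=> j i _; exact: affine_conformal].
    exact: connected_setT_lmod.
  exists 1 => // k w _ _ x y _ _; rewrite mul1r.
  rewrite (_ : compw _ _ _ = fun y =>
      (\prod_(j < size w) r (k + j)) *: y + offset k w); last first.
    by apply/funext => z; rewrite compw_gridE.
  by rewrite !dnorm_affine// prodr_ge0// => j _; exact: ltW.
- by exists eta => // j i _; rewrite normD_grid_map.
Qed.

Lemma ZnE n t :
  Zn (cube R d) grid_alphabet grid_map n t =
  ((branchings n ^ d)%:R * ratio n `^ t)%:E.
Proof.
rewrite /Zn (_ : words _ _ = [set` word_list 0 n]); last first.
  by apply/seteqP; split => w /= /word_listP.
rewrite esum_fset; [| exact: finite_seq |]; last first.
  by move=> w _; rewrite lee_fin powR_ge0.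
rewrite -fsbig_seq ?word_list_uniq//.
rewrite (eq_big_seq (fun=> (ratio n `^ t)%:E)); last first.
  by move=> w /word_listP[<- _]; rewrite normD_compw.
rewrite sumEFin big_const_seq count_predT size_word_list0 iter_addr_0.
by rewrite mulr_natl.
Qed.

Lemma ratio_le_exp n : ratio n <= eta ^+ n.
Proof.
rewrite /ratio -[n in leRHS]card_ord -prodr_const.
by apply: ler_prod => j _; rewrite ltW//=.
Qed.

Lemma ratio_small e : 0 < e -> exists n0, forall n, (n0 <= n)%N -> ratio n < e.
Proof.
move=> e0.
have eta0 : 0 <= eta by exact: le_trans (ltW (r_gt0 0)) (r_le_eta 0).
have : (fun n => eta ^+ n) @ \oo --> 0 by apply: cvg_expr; rewrite ger0_norm.
move=> /cvgr0_norm_lt /(_ e e0) [n0 _ h]; exists n0 => n /h /=.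
by rewrite ger0_norm ?exprn_ge0//; apply: le_lt_trans (ratio_le_exp n).
Qed.

(** * Lower bound for the dimension: mass distribution through ranks *)

Section LowerBound.
Variables (s C : R).
Hypotheses (s_gt0 : 0 < s) (s_le1 : s <= 1) (C_gt0 : 0 < C).
(** Per coordinate, a cluster below a word of length [k] carries the share [1 / M_k] of the mass;
    the bound says that this share is at most [C] times the [s]-th power of the cluster size. *)
Hypothesis frostman : forall k,
  1 <= C * (branchings k)%:R * ((m k)%:R * ratio k.+1) `^ s.

(** Interpolation inside a cluster. For [p = m k] this is [frostman] multiplied by [m k]; smaller
    [p] follow from [p = p ^ (1 - s) * p ^ s] and [p ^ (1 - s) <= m k ^ (1 - s)], where [s <= 1]
    enters. *)
Lemma digit_gap k p : (0 < p <= m k)%N ->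
  p%:R <= C * (branchings k.+1)%:R * (ratio k.+1 * p%:R) `^ s.
Proof.
move=> /andP[p0 pm].
have pR : 0 < p%:R :> R by rewrite ltr0n.
have mR : 0 < (m k)%:R :> R by rewrite ltr0n.
have rho0 := ltW (ratio_gt0 k.+1).
rewrite branchingsS natrM powRM ?(ltW pR)//.
have split_pow (x : R) : 0 < x -> x = x `^ (1 - s) * x `^ s.
  move=> x0; rewrite -powRD ?subrK ?powRr1 ?(ltW x0)//.
  by rewrite (gt_eqF x0) implybT.
rewrite [leLHS]split_pow// [(m k)%:R]split_pow//.
have le1 : (p%:R : R) `^ (1 - s) <= (m k)%:R `^ (1 - s).
  by apply: ge0_ler_powR; rewrite ?nnegrE ?subr_ge0 ?ler_nat.
have := frostman k; rewrite powRM ?(ltW mR)//.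
have : 0 <= (p%:R : R) `^ s by exact: powR_ge0.
have : 0 <= (m k)%:R `^ (1 - s) :> R by exact: powR_ge0.
move: (p%:R `^ (1 - s)) (p%:R `^ s) ((m k)%:R `^ (1 - s)) ((m k)%:R `^ s) le1.
move: (ratio k.+1 `^ s) (branchings k)%:R => a b u v w z uw w0 v0 h.
apply: (@le_trans _ _ (w * v * (C * b * (z * a)))).
  apply: (@le_trans _ _ (w * v)); first exact: ler_wpM2r.
  by rewrite ler_peMr// mulr_ge0.
by rewrite le_eqVlt; apply/orP; left; apply/eqP; ring.
Qed.

(** The case where the leading digits differ by [p >= 1]. The tails contribute at most [T] to the
    rank difference, which is thus at most [(p + 1) * T <= 2 * p * T]; the tail offsets lie in the
    cube, so the corners are at least [2 * p - 1 >= p] apart in units of [r k]. [digit_gap] compares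
    the two. *)
Lemma rank_holder_cons (c : 'I_d) k i i' w w' :
  size w = size w' -> (digit k i' c < digit k i c)%N ->
  `|(rank c k (i :: w))%:R - (rank c k (i' :: w'))%:R| <=
  2 * C * (branchings (k + (size w).+1))%:R *
    (ratio k * `|offset k (i :: w) 0 c - offset k (i' :: w') 0 c|) `^ s.
Proof.
move=> sw lt_digit.
rewrite !offset_cons -mulrBr normrM (gtr0_norm (r_gt0 k)) mulrA -ratioS.
set p := (digit k i c - digit k i' c)%N.
have pm : (0 < p <= m k)%N.
  by rewrite subn_gt0 lt_digit/= (leq_trans (leq_subr _ _))// ltnW// digit_lt.
set T := (\prod_(j < size w) m (k.+1 + j))%N.
have BT : branchings (k + (size w).+1) = (branchings k.+1 * T)%N.
  by rewrite -addSnnS branchingsD.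
have gap : p%:R <= `|2 * (digit k i c)%:R + offset k.+1 w 0 c -
                     (2 * (digit k i' c)%:R + offset k.+1 w' 0 c)|.
  have /cubeP/(_ c)/andP[u0 u1] := offset_cube k.+1 w.
  have /cubeP/(_ c)/andP[v0 v1] := offset_cube k.+1 w'.
  have : 1 <= (p%:R : R) by rewrite ler1n; case/andP: pm.
  rewrite /p natrB ?(ltnW lt_digit)// => p1.
  rewrite ger0_norm; lra.
apply: (@le_trans _ _ (2 * T%:R * p%:R)).
  have /= lt1 := rank_lt c k.+1 w; have /= lt2 := rank_lt c k.+1 w'.
  rewrite -sw in lt2 *; rewrite -/T in lt1 lt2 *.
  move: lt1 lt2; move: (rank c _ w) (rank c _ w') => a a' aT aT'.
  have {}aT : a%:R <= T%:R :> R by rewrite ler_nat ltnW.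
  have {}aT' : a'%:R <= T%:R :> R by rewrite ler_nat ltnW.
  have a0 : 0 <= a%:R :> R by [].
  have a0' : 0 <= a'%:R :> R by [].
  have T0 : 0 <= T%:R :> R by [].
  have p1 : 1 <= (p%:R : R) by rewrite ler1n; case/andP: pm.
  have Tp : T%:R <= T%:R * p%:R :> R by rewrite ler_peMr.
  rewrite !natrD !natrM -(subnK (ltnW lt_digit)) -/p natrD.
  by rewrite ler_norml; apply/andP; split; nra.
have h := digit_gap k p pm.
rewrite BT natrM.
apply: (@le_trans _ _ (2 * T%:R * (C * (branchings k.+1)%:R * (ratio k.+1 * p%:R) `^ s))).
  by apply: ler_wpM2l => //; rewrite mulr_ge0.
have regroup x : 2 * T%:R * (C * (branchings k.+1)%:R * x) =
    2 * C * ((branchings k.+1)%:R * T%:R) * x :> R by ring.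
rewrite regroup; apply: ler_wpM2l; first by rewrite !mulr_ge0// ltW.
apply: ge0_ler_powR; rewrite ?nnegrE ?mulr_ge0 ?(ltW s_gt0) ?(ltW (ratio_gt0 _))//.
by rewrite ler_wpM2l// ltW// ratio_gt0.
Qed.

(** Common leading digits cancel on both sides, so induction reaches the first difference. The
    factor [ratio k] measures distances at the scale of level [k], which keeps the bound invariant
    when a digit is removed. *)
Lemma rank_holder (c : 'I_d) k w w' : size w = size w' ->
  `|(rank c k w)%:R - (rank c k w')%:R| <=
  2 * C * (branchings (k + size w))%:R *
    (ratio k * `|offset k w 0 c - offset k w' 0 c|) `^ s.
Proof.
elim: w k w' => [|i w IH] k [|i' w']//=.
  by rewrite subrr normr0 !mulr_ge0 ?powR_ge0// ltW.
move=> [sw]; case: (ltngtP (digit k i c) (digit k i' c)) => hd.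
- rewrite distrC (distrC (offset _ _ _ _)).
  have -> : (k + (size w).+1 = k + (size w').+1)%N by rewrite sw.
  exact: (rank_holder_cons c k i' i w' w (esym sw) hd).
- exact: (rank_holder_cons c k i i' w w' sw hd).
rewrite !offset_cons -mulrBr normrM (gtr0_norm (r_gt0 k)) mulrA -ratioS hd.
rewrite opprD addrACA subrr add0r sw !natrD opprD addrACA subrr add0r.
by rewrite -sw -addSnnS; exact: IH.
Qed.

(** By [rank_holder] the ranks of the counted words differ by less than [L.+1] in each coordinate,
    so their residues modulo [L.+1] determine them. Hence a word is determined by [d] residues. *)
Lemma count_offset_in n (U : set 'rV[R]_d) D : 0 <= D ->
  (forall x y c, U x -> U y -> `|x 0 c - y 0 c| <= D) ->
  (count (fun w => `[< U (offset 0 w) >]) (word_list 0 n) <=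
   (Num.truncn (2 * C * (branchings n)%:R * D `^ s)).+1 ^ d)%N.
Proof.
move=> D0 diamU; set L := (X in (_ <= X.+1 ^ d)%N).
rewrite -size_filter; set l := (X in (size X <= _)%N).
pose f w : {ffun 'I_d -> 'I_L.+1} := [ffun c : 'I_d => inord (rank c 0 w %% L.+1)].
have lP w : w \in l -> U (offset 0 w) /\ w \in word_list 0 n.
  by rewrite mem_filter => /andP[/asboolP].
have f_inj : {in l &, injective f}.
  move=> w w' /lP[Uw wn] /lP[Uw' wn'] /ffunP fww'.
  apply: (rank_inj 0 n) => // c cd.
  have := congr1 (@nat_of_ord _) (fww' (Ordinal cd)); rewrite !ffunE !inordK ?ltn_mod//=.
  have [[sw _] [sw' _]] := (word_listP _ _ _ wn, word_listP _ _ _ wn').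
  have := rank_holder (Ordinal cd) 0 w w' (etrans sw (esym sw')).
  rewrite add0n sw /ratio big_ord0 mul1r /=.
  move: (rank c 0 w) (rank c 0 w') => a a' le_aa' aa'.
  have {}le_aa' : `|a%:R - a'%:R| < L.+1%:R :> R.
    apply: le_lt_trans (truncnS_gt _); apply: le_trans le_aa' _.
    apply: ler_wpM2l; first by rewrite !mulr_ge0// ltW.
    apply: ge0_ler_powR; rewrite ?nnegrE ?(ltW s_gt0)//.
    exact: diamU.
  have [d1 d2] : (a < a' + L.+1)%N /\ (a' < a + L.+1)%N.
    by move: le_aa'; rewrite -!(ltr_nat R) ltr_norml !natrD => /andP[? ?]; split; lra.
  have := divn_eq a L.+1; have := divn_eq a' L.+1; rewrite aa'.
  move: (a %/ L.+1)%N (a' %/ L.+1)%N (a' %% L.+1)%N => q q' t e e'.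
  case: (ltngtP q q') => qq'; last by rewrite e e' qq'.
  - by have := leq_mul qq' (leqnn L.+1); rewrite mulSn; lia.
  - by have := leq_mul qq' (leqnn L.+1); rewrite mulSn; lia.
have : uniq (map f l) by rewrite map_inj_in_uniq// filter_uniq// word_list_uniq.
move=> /card_uniqP; rewrite size_map => <-.
by apply: leq_trans (max_card _) _; rewrite card_ffun !card_ord.
Qed.

(** The letter 0 fixes the origin, so padding [w] by zeros does not move its corner; prefixes of the
    padded word witness membership at every level. *)
Lemma offset_limit_set n w : w \in word_list 0 n ->
  limit_set (cube R d) grid_alphabet grid_map (offset 0 w).
Proof.
move=> /word_listP[sw vw] k _; exists (take k (w ++ nseq (k - n) 0%N)).
  split.
    rewrite size_takel// size_cat size_nseq sw; lia.
  move=> j; rewrite size_take_min => jk.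
  rewrite nth_take; last by apply: leq_trans jk (geq_minl _ _).
  rewrite nth_cat; case: ifP => jw; first exact: vw.
  by rewrite nth_nseq if_same /grid_alphabet /= expn_gt0 m_gt0.
set u := w ++ _.
exists (offset k (drop k u)); first exact: offset_cube.
have ku : size (take k u) = k.
  by rewrite size_takel// size_cat size_nseq sw; lia.
have -> : offset k (drop k u) = offset (0 + size (take k u)) (drop k u).
  by rewrite ku.
by rewrite /offset -compw_cat cat_take_drop /u compw_cat -!/(offset _ _) offset_zeros.
Qed.

(** Each level is a finite union of compact sets because the alphabets are finite. *)
Lemma limit_set_compact :
  compact (limit_set (cube R d) grid_alphabet grid_map).
Proof.
apply: (subclosed_compact _ (cube_compact R d)); last first.
  by move=> x /(_ 0%N I)[w [/size0nil -> _] [y Xy <-]].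
apply: closed_bigI => n _; apply: closed_bigcup => [|w _].
  rewrite (_ : words _ _ = [set` word_list 0 n]); first exact: finite_seq.
  by apply/seteqP; split => w /= /word_listP.
apply: compact_closed; first exact: norm_hausdorff.
apply: continuous_compact (cube_compact R d).
apply: continuous_subspaceT => x.
rewrite (_ : compw _ _ _ = fun y => ratio (size w) *: y + offset 0 w).
  apply: differentiable_continuous.
  by have h := affine_is_diff R d (ratio (size w)) (offset 0 w) x.
by apply/funext => y; rewrite compw_grid0E.
Qed.

(** At a level [n] with cubes smaller than every [g i], each of the [M_n ^ d] corners lies in some
    [U i]; summing the counts of [count_offset_in] and dividing by [M_n ^ d] gives the bound. *)
Lemma cover_mass N (U : 'I_N -> set 'rV[R]_d) (g : 'I_N -> R) :
  (forall i, 0 < g i) ->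
  (forall i x y c, U i x -> U i y -> `|x 0 c - y 0 c| <= g i) ->
  limit_set (cube R d) grid_alphabet grid_map `<=` \bigcup_i U i ->
  1 <= (3 * C) ^+ d * \sum_(i < N) g i `^ (s * d%:R).
Proof.
move=> g0 Ug cov.
have [n ng] : exists n, forall i, ratio n < g i.
  have /choice[n0 hn0] i := ratio_small _ (g0 i).
  exists (\max_i n0 i)%N => i; apply: hn0; exact: leq_bigmax.
have B0 := branchings_gt0 n.
have BR : 0 < (branchings n)%:R :> R by rewrite ltr0n.
have cnt : (branchings n ^ d <= \sum_(i < N)
    (Num.truncn (2 * C * (branchings n)%:R * g i `^ s)).+1 ^ d)%N.
  rewrite -size_word_list0.
  apply: leq_trans (size_le_sum_count _ _ _
      (fun i w => `[< U i (offset 0 w) >]) _) _.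
    move=> w /offset_limit_set /cov[i _ Ui]; exists i; exact/asboolP.
  apply: leq_sum => i _; apply: count_offset_in; first exact: ltW.
  exact: Ug.
(* This absorbs the 1 added by rounding up, whence [3 * C] instead of [2 * C]. It rests on
   [m n * rho_(n+1) <= rho_n < g i]. *)
have big i : 1 <= C * (branchings n)%:R * g i `^ s.
  apply: le_trans (frostman n) _.
  apply: ler_wpM2l; first by rewrite mulr_ge0// ltW.
  apply: ge0_ler_powR; rewrite ?nnegrE ?(ltW s_gt0) ?mulr_ge0
    ?(ltW (g0 _)) ?(ltW (ratio_gt0 _))//.
  apply: le_trans (ltW (ng i)).
  rewrite ratioS mulrCA ler_piMr ?(ltW (ratio_gt0 _))//.
  have := room n; have : 1 <= (m n)%:R :> R by rewrite ler1n.
  by have := r_gt0 n; move: (r n) (m n)%:R => q M *; nra.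
have step : (branchings n)%:R ^+ d <=
    (branchings n)%:R ^+ d * ((3 * C) ^+ d * \sum_(i < N) g i `^ (s * d%:R)).
  move: cnt; rewrite -(ler_nat R) natrX natr_sum => /le_trans; apply.
  rewrite mulrA -exprMn mulr_sumr; apply: ler_sum => i _.
  rewrite powRrM powR_mulrn ?powR_ge0// -exprMn natrX.
  rewrite lerXn2r ?nnegrE ?mulr_ge0 ?powR_ge0 ?(ltW C_gt0)//.
  rewrite -natr1.
  have : (Num.truncn (2 * C * (branchings n)%:R * g i `^ s))%:R <=
      2 * C * (branchings n)%:R * g i `^ s.
    by rewrite truncn_le !mulr_ge0 ?powR_ge0// ltW.
  by have := big i; lra.
by rewrite -(ler_pM2l (exprn_gt0 d BR)) mulr1.
Qed.

(** At scale 1 the diameters are at most 1, so costs at exponent [s'] dominate those at [s * d]; a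
    finite subcover of a slightly fattened cover is then subject to [cover_mass]. *)
Lemma Hdelta_limit_set_ge s' : s' <= s * d%:R ->
  ((((3 * C) ^+ d)^-1 / 2)%:E <=
   Hdelta s' 1 (limit_set (cube R d) grid_alphabet grid_map))%E.
Proof.
move=> s's; set c0 := ((3 * C) ^+ d)^-1.
have c3 : 0 < (3 * C) ^+ d by rewrite exprn_gt0// mulr_gt0.
have c00 : 0 < c0 by rewrite invr_gt0.
set t := s * d%:R; have t0 : 0 < t by rewrite mulr_gt0// ltr0n.
apply: le_ereal_inf_tmp => _ [U [cov U1] <-].
have diamU1 n : diam (U n) <= 1 by apply: diam_le => // x y; exact: U1.
(* The covering sets are fattened to open sets; [g n] is their diameter bound,
   chosen so that the fattening adds at most [c0 / 2] to the total cost. *)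
pose D n := diam (U n); pose e n : R := c0 / 2 * 2^-1 ^+ n.+1.
have e0 n : 0 < e n by rewrite mulr_gt0 ?divr_gt0// exprn_gt0 ?invr_gt0.
pose g n := (D n `^ t + e n) `^ t^-1.
have sum0 n : 0 < D n `^ t + e n by rewrite ltr_wpDl ?powR_ge0.
have gt n : g n `^ t = D n `^ t + e n.
  by rewrite /g -powRrM mulVf ?gt_eqF// powRr1// ltW.
have Dg n : D n < g n.
  have -> : D n = (D n `^ t) `^ t^-1.
    by rewrite -powRrM mulfV ?gt_eqF// powRr1// diam_ge0.
  apply: gt0_ltr_powR; rewrite ?invr_gt0// ?nnegrE ?powR_ge0 ?(ltW (sum0 _))//.
  by rewrite ltrDl.
pose rad n := (g n - D n) / 2.
have rad0 n : 0 < rad n by rewrite divr_gt0// subr_gt0.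
pose V n : set 'rV[R]_d := \bigcup_(x in U n) ball x (rad n).
have Vg n x y c : V n x -> V n y -> `|x 0 c - y 0 c| <= g n.
  move=> [x' Ux' [_ /(_ 0 c) xx']] [y' Uy' [_ /(_ 0 c) yy']].
  have h := diam_ge _ _ _ _ _ _ (U1 n) Ux' Uy'.
  have {h} := le_trans (coord_le_edist _ _ x' y' c) h.
  move: xx' yy'; rewrite /ball /= -/(D n) /rad.
  rewrite !ltr_norml !ler_norml => /andP[? ?] /andP[? ?] /andP[? ?].
  by apply/andP; split; lra.
have : cover_compact (limit_set (cube R d) grid_alphabet grid_map).
  rewrite -compact_cover; exact: limit_set_compact.
move=> /(_ nat setT V)[|x /cov[n _ Ux]|F _ covF].
- move=> n _; apply: bigcup_open => x _; exact: ball_open.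
- by exists n => //; exists x => //; exact: ballxx.
(* The finite subcover is enlarged to an initial segment of the cover. *)
pose N := (\max_(i <- enum_fset F) i).+1.
have g0 n : 0 < g n by apply: le_lt_trans (Dg n); exact: diam_ge0.
have covN : limit_set (cube R d) grid_alphabet grid_map `<=`
    \bigcup_(i in [set: 'I_N]) V i.
  move=> x /covF[i Fi Vi].
  have iN : (i < N)%N by rewrite ltnS; apply: (@leq_bigmax_seq _ _ _ id).
  by exists (Ordinal iN).
have := cover_mass N (fun i => V i) (fun i => g i) (fun i => g0 i)
  (fun i => Vg i) covN.
under eq_bigr do rewrite -/t gt.
rewrite big_split/= -mulr_sumr sum_half_pow -ler_pdivrMl// mulr1 -/c0 => mass.
apply: (@le_trans _ _ (\sum_(0 <= i < N) Hcost s' (U i))%E); last first.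
  by apply: nneseries_lim_ge => i _ _; exact: Hcost_ge0.
rewrite big_mkord.
apply: (@le_trans _ _ (\sum_(i < N) (D i `^ t)%:E)%E); last first.
  by apply: lee_sum => i _; exact: le_Hcost.
rewrite sumEFin lee_fin.
have : 0 <= c0 / 2 * 2^-1 ^+ N by rewrite mulr_ge0 ?exprn_ge0// divr_ge0// ltW.
by move: mass; rewrite mulrBr mulr1; lra.
Qed.

End LowerBound.

End GridSystem.

(** * Criteria for upper and lower limits *)

Lemma limn_esup_le (R : realType) (u : nat -> \bar R) (c : \bar R) N :
  (forall n, (N <= n)%N -> (u n <= c)%E) -> (limn_esup u <= c)%E.
Proof.
move=> uc; apply: ge_ereal_inf; exists (ereal_sup [set u n | n in [set n | (N <= n)%N]]).
  by exists [set n | (N <= n)%N] => //; exists N.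
by apply: ge_ereal_sup => _ [n /= Nn <-]; exact: uc.
Qed.

Lemma le_limn_esup (R : realType) (u : nat -> \bar R) (c : \bar R) :
  (forall e : R, 0 < e -> forall N, exists2 n, (N <= n)%N & (c <= u n + e%:E)%E) ->
  (c <= limn_esup u)%E.
Proof.
move=> uc; apply: le_ereal_inf_tmp => _ [V [N _ NV] <-].
apply/lee_addgt0Pr => e e0; have [n Nn cu] := uc e e0 N.
apply: le_trans cu _; rewrite leeD2r//.
by apply: le_ereal_sup_tmp; exists (u n) => //; exists n => //; exact: NV.
Qed.

Lemma le_limn_einf (R : realType) (u : nat -> \bar R) (c : \bar R) N :
  (forall n, (N <= n)%N -> (c <= u n)%E) -> (c <= limn_einf u)%E.
Proof.
move=> uc; rewrite /limn_einf -[c]oppeK leeN2.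
by apply: (@limn_esup_le _ _ _ N) => n Nn; rewrite leeN2 uc.
Qed.

Lemma limn_einf_le0 (R : realType) (u : nat -> \bar R) :
  (forall e : R, 0 < e -> forall N, exists2 n, (N <= n)%N & (u n <= e%:E)%E) ->
  (limn_einf u <= 0)%E.
Proof.
move=> uc; rewrite /limn_einf -oppe0 leeN2; apply: le_limn_esup => e e0 N.
have [n Nn ue] := uc e e0 N; exists n => //.
case: (u n) ue => [x| |] //=; last by rewrite leey.
by rewrite -[(_ + _)%E]/((- x + e)%:E) !lee_fin; lra.
Qed.

(** * The integer sequence with sparse jumps *)

Section JumpSequence.
Variables (q g s0 : nat).
Hypotheses (q_gt0 : (0 < q)%N) (g_gt1 : (1 < g)%N) (s0_gt0 : (0 < s0)%N).

Fixpoint jump_seq n : nat :=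
  if n is n'.+1 then
    if n == (q * g * jump_seq n')%N then (g * jump_seq n')%N else jump_seq n'
  else s0.

Lemma jump_seqS n : jump_seq n.+1 =
  if n.+1 == (q * g * jump_seq n)%N then (g * jump_seq n)%N else jump_seq n.
Proof. by []. Qed.

Lemma jump_seq_leS n : (jump_seq n <= jump_seq n.+1)%N.
Proof. by rewrite jump_seqS; case: ifP => // _; rewrite leq_pmull// ltnW. Qed.

Lemma jump_seqS_le n : (jump_seq n.+1 <= g * jump_seq n)%N.
Proof. by rewrite jump_seqS; case: ifP => // _; rewrite leq_pmull// ltnW. Qed.

Lemma jump_seq_ge n : (s0 <= jump_seq n)%N.
Proof. by elim: n => // n IH; exact: leq_trans IH (jump_seq_leS n). Qed.

(** The next jump level always lies ahead: when it is reached, the jump multiplies it by [g > 1]. *)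
Lemma jump_seq_gt n : (n < q * g * jump_seq n)%N.
Proof.
have g0 := ltnW g_gt1.
elim: n => [|n IH]; first by rewrite !muln_gt0 q_gt0 g0.
rewrite jump_seqS; case: eqP => [e|ne]; last by rewrite ltn_neqAle IH andbT; apply/eqP.
rewrite mulnCA -e; apply: ltn_Pmull => //.
Qed.

Lemma jump_seq_step n :
  jump_seq n.+1 = jump_seq n \/
  (jump_seq n + (g - 1) * s0 <= jump_seq n.+1)%N.
Proof.
rewrite jump_seqS; case: ifP => _; [right | by left].
rewrite -{2}(subnK (ltnW g_gt1)) mulnDl mul1n addnC leq_add2r.
by rewrite leq_mul2l jump_seq_ge orbT.
Qed.

(** At a jump the increment is at most [g * jump_seq n], and [q] times this is the level [n.+1]. *)
Lemma jump_seq_diff n : (q * (jump_seq n.+1 - jump_seq n) <= n.+1)%N.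
Proof.
rewrite jump_seqS; case: eqP => [e|_]; last by rewrite subnn muln0.
by rewrite [leqRHS]e -mulnA leq_mul2l leq_subr orbT.
Qed.

(** Without further jumps the sequence would be constant from [N] on, and [jump_seq_gt] would bound
    all levels. *)
Lemma jump_seq_jumps N : exists2 n, (N <= n)%N & n.+1 = (q * g * jump_seq n)%N.
Proof.
apply: contrapT => /forall2NP nojump.
have cst k : jump_seq (N + k) = jump_seq N.
  elim: k => [|k IH]; first by rewrite addn0.
  rewrite addnS jump_seqS; case: eqP => [e|_]; last exact: IH.
  by have [|] := nojump (N + k)%N; rewrite ?leq_addr.
by have := jump_seq_gt (N + (q * g * jump_seq N)); rewrite cst; lia.
Qed.

End JumpSequence.

(** * The grid system driven by the jump sequence *)

Section JumpSystem.
Variables (R : realType) (d q g s0 : nat) (kap bet : R).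
Hypotheses (d_gt0 : (0 < d)%N) (q_gt0 : (0 < q)%N) (g_gt1 : (1 < g)%N)
  (s0_gt0 : (0 < s0)%N) (kap_gt0 : 0 < kap) (bet_ge1 : 1 <= bet).
Hypothesis jump_room : 1 <= (bet - 1) * ((g - 1) * s0)%:R.

Local Notation S := (jump_seq q g s0).
Local Notation pow2 x := ((2 : R) `^ x).

Definition jump_exponent j : nat := (S j.+1 - S j)%N.
Definition jump_branching j : nat := (2 ^ jump_exponent j)%N.
Definition jump_ratio j : R := pow2 (- (kap + bet * (jump_exponent j)%:R)).

Local Notation m := jump_branching.
Local Notation r := jump_ratio.

Lemma natr_pow2 k : (2 ^ k)%:R = pow2 k%:R.
Proof. by rewrite natrX powR_mulrn. Qed.

Lemma pow2D x y : pow2 (x + y) = pow2 x * pow2 y.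
Proof. by rewrite powRD// pnatr_eq0 implybT. Qed.

Lemma pow2_le x y : x <= y -> pow2 x <= pow2 y.
Proof. by move=> xy; apply: ler_powR => //; rewrite ler1n. Qed.

Lemma pow2_lt1 x : x < 0 -> pow2 x < 1.
Proof.
move=> x0; rewrite /powR pnatr_eq0 /= expR_lt1 nmulr_rlt0//.
by apply: ln_gt0; rewrite ltr1n.
Qed.

Lemma jump_exponentE j : (jump_exponent j)%:R = (S j.+1)%:R - (S j)%:R :> R.
Proof. by rewrite natrB// jump_seq_leS. Qed.

Lemma jump_branching_gt0 j : (0 < m j)%N.
Proof. by rewrite expn_gt0. Qed.

Lemma jump_ratio_gt0 j : 0 < r j.
Proof. exact: powR_gt0. Qed.

Lemma branchings_jumpE n : branchings m n = (2 ^ (S n - s0))%N.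
Proof.
elim: n => [|n IH]; first by rewrite /branchings big_ord0 subnn.
rewrite branchingsS IH -expnD; congr (_ ^ _)%N.
have := jump_seq_leS q g s0 g_gt1 n; have := jump_seq_ge q g s0 g_gt1 n.
by rewrite /jump_exponent; lia.
Qed.

Lemma ratio_jumpE n :
  ratio R r n = pow2 (- (kap * n%:R + bet * ((S n)%:R - s0%:R))).
Proof.
elim: n => [|n IH].
  by rewrite /ratio big_ord0 subrr !mulr0 addr0 oppr0 powRr0.
rewrite ratioS IH -pow2D jump_exponentE; congr (_ `^ _).
by rewrite -[n.+1]addn1 natrD; ring.
Qed.

Lemma branchings_jump_pow2 n : (branchings m n)%:R = pow2 ((S n)%:R - s0%:R).
Proof. by rewrite branchings_jumpE natr_pow2 natrB// jump_seq_ge. Qed.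

(** Off the jumps [m j = 1] and the claim is [r j <= 1]. At a jump the exponent is at least
    [(g - 1) * s0], so [jump_room] makes the surplus contraction [(bet - 1) * E] pay for the factor
    2. *)
Lemma jump_ratio_room j : r j * (2 * (m j)%:R - 1) <= 1.
Proof.
rewrite /jump_ratio /jump_branching.
have [|] := jump_seq_step q g s0 g_gt1 j.
  rewrite /jump_exponent => ->; rewrite subnn mulr0 addr0 expn0.
  rewrite (_ : 2 * _ - 1 = 1 :> R) ?mulr1; last by ring.
  by rewrite ltW// pow2_lt1// oppr_lt0.
rewrite natr_pow2 => big_step.
have Ebig : 1 <= (bet - 1) * (jump_exponent j)%:R.
  apply: le_trans jump_room _; apply: ler_wpM2l; first by rewrite subr_ge0.
  by rewrite ler_nat /jump_exponent; lia.
move: (jump_exponent j)%:R Ebig => E Ebig.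
apply: (@le_trans _ _ (pow2 (- (kap + bet * E)) * (pow2 1 * pow2 E))).
  by rewrite powRr1// ler_pM2l ?powR_gt0// gerDl lerN10.
rewrite -!pow2D -[leRHS](powRr0 2); apply: pow2_le.
by move: kap_gt0 Ebig; rewrite mulrBl mul1r; lra.
Qed.

Lemma jump_ratio_le j : r j <= pow2 (- kap).
Proof. by apply: pow2_le; rewrite lerN2 lerDl mulr_ge0// (le_trans ler01). Qed.

Lemma cluster_jumpE n :
  (m n)%:R * ratio R r n.+1 =
  pow2 ((S n.+1)%:R - (S n)%:R - kap * n.+1%:R - bet * ((S n.+1)%:R - s0%:R)).
Proof.
rewrite /jump_branching natr_pow2 ratio_jumpE -pow2D jump_exponentE.
by congr (_ `^ _); ring.
Qed.

Lemma jump_seq_large (A : R) : exists N, forall n, (N <= n)%N -> A <= (S n)%:R.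
Proof.
exists ((Num.truncn A).+1 * (q * g))%N => n Nn.
apply: ltW; apply: (lt_le_trans (truncnS_gt A)); rewrite ler_nat.
have h := jump_seq_gt q g s0 q_gt0 g_gt1 s0_gt0 n.
have g0 := ltnW g_gt1.
rewrite -(@leq_pmul2r (q * g)%N) ?muln_gt0 ?q_gt0//.
by apply: leq_trans Nn _; rewrite mulnC ltnW.
Qed.

Lemma Zn_jumpE n t :
  Zn (cube R d) (grid_alphabet d m) (grid_map R d m r) n t =
  (pow2 (d%:R * ((S n)%:R - s0%:R)
         - t * (kap * n%:R + bet * ((S n)%:R - s0%:R))))%:E.
Proof.
rewrite ZnE//; last exact: jump_ratio_gt0.
rewrite natrX branchings_jump_pow2 ratio_jumpE -powR_mulrn ?powR_ge0//.
by rewrite -!powRrM -pow2D; congr (_ `^ _)%:E; ring.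
Qed.

Lemma elog_pow2 (x : R) : elog (pow2 x)%:E = (x * ln 2)%:E.
Proof. by rewrite /elog powR_gt0// ln_powR. Qed.

Lemma ecard_jump j : ecard (grid_alphabet d m j) = (pow2 (d * jump_exponent j)%:R)%:E.
Proof.
have I_eq : (grid_alphabet d m j #= `I_(m j ^ d))%card by [].
rewrite /ecard; case: pselect => [fin|]; last by case; exists (m j ^ d)%N.
by rewrite (card_fset_set I_eq) /jump_branching -expnM mulnC natr_pow2.
Qed.

(** The alphabet has [2 ^ (d * E)] letters with [q * E <= j.+1], so its growth rate is at most
    [d * ln 2 / q]. *)
Lemma jump_growth (eps : R) : d%:R * ln 2 <= eps * q%:R ->
  (limn_esup (fun j => ((j.+1%:R)^-1)%:E * elog (ecard (grid_alphabet d m j)))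
   <= eps%:E)%E.
Proof.
move=> q_large; apply: (@limn_esup_le _ _ _ 0%N) => j _.
rewrite ecard_jump elog_pow2 -EFinM lee_fin ler_pdivrMl ?ltr0n//.
have ln2 : 0 < ln (2 : R) by rewrite ln_gt0// ltr1n.
have qR : 0 < q%:R :> R by rewrite ltr0n.
have eps0 : 0 <= eps by rewrite -(pmulr_lge0 _ qR) (le_trans _ q_large)// mulr_ge0// ltW.
have : q%:R * (jump_exponent j)%:R <= j.+1%:R :> R.
  by rewrite -natrM ler_nat jump_seq_diff.
move=> /(ler_wpM2l eps0); rewrite [j.+1%:R * _]mulrC; apply: le_trans.
have E0 : 0 <= (jump_exponent j)%:R :> R by [].
by have := ler_wpM2r E0 q_large; rewrite natrM; lra.
Qed.

Lemma jump_NCIFS : NCIFS (cube R d) (grid_alphabet d m) (grid_map R d m r).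
Proof.
apply: (grid_NCIFS _ _ _ _ jump_branching_gt0 jump_ratio_gt0 jump_ratio_room
  d_gt0 (pow2 (- kap)) jump_ratio_le).
by rewrite pow2_lt1// oppr_lt0.
Qed.

(** * Hausdorff dimension of the limit set *)

Section Dimension.
Variable tau1 : R.
Hypotheses (tau1_gt0 : 0 < tau1) (tau1_le1 : tau1 <= 1).
Hypothesis tau1E : tau1^-1 = kap * (q * g)%:R + (bet - 1) * g%:R + 1.

(** In base 2 the exponent is [tau1] times a sum of three nonnegative terms, which come from
    [k.+1 <= q * g * S k], from [S k.+1 <= g * S k] and from [bet * s0]. The constant [2 ^ s0]
    cancels the [s0] in [branchings]. *)
Lemma jump_frostman k :
  1 <= pow2 s0%:R * (branchings m k)%:R * ((m k)%:R * ratio R r k.+1) `^ tau1.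
Proof.
rewrite branchings_jump_pow2 cluster_jumpE -powRrM -!pow2D -[leLHS](powRr0 2).
apply: pow2_le.
have lt1 : k.+1%:R <= (q * g)%:R * (S k)%:R :> R.
  by rewrite -natrM ler_nat jump_seq_gt.
have lt2 : (S k.+1)%:R <= g%:R * (S k)%:R :> R.
  by rewrite -natrM ler_nat jump_seqS_le.
have h1 := mulr_ge0 (ltW kap_gt0) (etrans (subr_ge0 _ _) lt1).
have h2 : 0 <= (bet - 1) * (g%:R * (S k)%:R - (S k.+1)%:R).
  by rewrite mulr_ge0// subr_ge0.
have h3 : 0 <= bet * s0%:R by rewrite mulr_ge0// (le_trans ler01).
set X := _ - bet * (_ - _).
have key : 0 <= (S k)%:R * tau1^-1 + X by rewrite tau1E /X; lra.
have -> : s0%:R + ((S k)%:R - s0%:R) + X * tau1 =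
    tau1 * ((S k)%:R * tau1^-1 + X) by field; rewrite gt_eqF.
by rewrite mulr_ge0// ltW.
Qed.

(** At a jump both inequalities behind [jump_frostman] are equalities, so the exponent is
    [S n * (1 - s / tau1)] plus a constant and falls below [ln e / ln 2] once [S n] is large. *)
Lemma jump_thin s : tau1 < s -> forall e, 0 < e ->
  exists n, (branchings m n)%:R * ((m n)%:R * ratio R r n.+1) `^ s < e.
Proof.
move=> tau1s e e0.
have s_gt0 : 0 < s by exact: lt_trans tau1s.
have a0 : 0 < s / tau1 - 1 by rewrite subr_gt0 ltr_pdivlMr// mul1r.
have ln2 : 0 < ln (2 : R) by rewrite ln_gt0// ltr1n.
have [N NS] := jump_seq_large ((s * bet * s0%:R + 1 - ln e / ln 2) / (s / tau1 - 1)).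
have [n /NS + jump] := jump_seq_jumps q g s0 q_gt0 g_gt1 s0_gt0 N.
rewrite ler_pdivrMr// => Sn.
exists n; rewrite branchings_jump_pow2 cluster_jumpE -powRrM -pow2D.
have -> : (S n.+1)%:R = g%:R * (S n)%:R :> R.
  by rewrite jump_seqS {1}jump eqxx natrM.
rewrite jump !natrM.
set x := _ + _.
have -> : x = (S n)%:R * (1 - s / tau1) + s0%:R * (s * bet - 1).
  by rewrite /x tau1E natrM; ring.
rewrite /powR pnatr_eq0/= -[ltRHS]lnK ?posrE// ltr_expR -ltr_pdivlMr//.
have : 0 <= s0%:R :> R by [].
by lra.
Qed.

Lemma HD_jump :
  HD (limit_set (cube R d) (grid_alphabet d m) (grid_map R d m r)) =
  (tau1 * d%:R)%:E.
Proof.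
have dR : 0 < d%:R :> R by rewrite ltr0n.
apply/eqP; rewrite eq_le; apply/andP; split.
  apply/lee_addgt0Pr => e e0; apply: ge_ereal_inf.
  exists ((tau1 + e / d%:R) * d%:R)%:E; last first.
    by rewrite -EFinD lee_fin mulrDl divfK ?gt_eqF.
  have tau1e : tau1 < tau1 + e / d%:R by rewrite ltrDl divr_gt0.
  exists ((tau1 + e / d%:R) * d%:R) => //; split.
    by rewrite mulr_ge0// addr_ge0 ?ltW// divr_gt0.
  apply: Hmeasure_limit_set_eq0 => //.
  - exact: jump_branching_gt0.
  - exact: jump_ratio_gt0.
  - exact: lt_trans tau1e.
  - exact: jump_thin.
apply: le_ereal_inf_tmp => _ [s [s0' Hs0] <-]; rewrite lee_fin leNgt.
apply/negP => s_lt.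
have C0 : 0 < pow2 s0%:R by exact: powR_gt0.
have := Hdelta_limit_set_ge R d m r jump_branching_gt0 jump_ratio_gt0
  jump_ratio_room d_gt0 (pow2 (- kap)) jump_ratio_le _ tau1 (pow2 s0%:R)
  tau1_gt0 tau1_le1 C0 jump_frostman s (ltW s_lt).
have kap1 : pow2 (- kap) < 1 by rewrite pow2_lt1// oppr_lt0.
move=> /(_ kap1) lower.
have : (Hdelta s 1 (limit_set (cube R d) (grid_alphabet d m) (grid_map R d m r))
    <= 0)%E.
  by rewrite -Hs0; apply: le_ereal_sup_tmp; exists (Hdelta s 1
    (limit_set (cube R d) (grid_alphabet d m) (grid_map R d m r))) => //; exists 1 => /=.
by move=> /(le_trans lower); rewrite lee_fin leNgt divr_gt0// invr_gt0 exprn_gt0//.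
Qed.

End Dimension.

(** * Lower pressure and the Bowen exponent *)

Section Pressure.
Variable tau2 : R.
Hypothesis tau2_gt0 : 0 < tau2.
Hypothesis tau2E : tau2^-1 = kap * (q * g)%:R + bet.

(** With [n <= q * g * S n] the base 2 exponent of [Z_n] is at least [a * S n - d * s0]. For large
    [n] this exceeds [a * S n / 2], hence a positive multiple of [n]. *)
Lemma lower_pressure_jump_gt0 t : 0 <= t -> t < tau2 * d%:R ->
  (0 < lower_pressure (cube R d) (grid_alphabet d m) (grid_map R d m r) t)%E.
Proof.
move=> t0 t_lt.
have dR : 0 < d%:R :> R by rewrite ltr0n.
have ln2 : 0 < ln (2 : R) by rewrite ln_gt0// ltr1n.
have qg0 : 0 < (q * g)%:R :> R by rewrite ltr0n muln_gt0 q_gt0 ltnW.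
set a := d%:R - t * tau2^-1.
have a0 : 0 < a by rewrite subr_gt0 ltr_pdivrMr// mulrC.
set c := a / (2 * (q * g)%:R) * ln 2.
have c0 : 0 < c by rewrite mulr_gt0// divr_gt0// mulr_gt0.
have [N NS] := jump_seq_large (2 * (s0%:R * d%:R) / a).
apply: (@lt_le_trans _ _ c%:E); first by rewrite lte_fin.
apply: (@le_limn_einf _ _ _ N) => n Nn.
rewrite Zn_jumpE elog_pow2 -EFinM lee_fin ler_pdivlMl ?ltr0n//.
rewrite /c mulrA ler_pM2r//.
have := NS n.+1 (leqW Nn); rewrite ler_pdivrMr// => Sbig.
have : n.+1%:R <= (q * g)%:R * (S n.+1)%:R :> R.
  by rewrite -natrM ler_nat ltnW// jump_seq_gt.
move: (n.+1%:R) (S n.+1)%:R Sbig => x y Sbig xy.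
have h1 : 0 <= kap * t * ((q * g)%:R * y - x).
  by rewrite mulr_ge0 ?subr_ge0// mulr_ge0// ltW.
have h2 : 0 <= t * bet * s0%:R.
  by rewrite !mulr_ge0// (le_trans ler01).
have aE : y * a = y * d%:R - y * t * (kap * (q * g)%:R + bet).
  by rewrite /a tau2E; ring.
have h3 : x * (a / (2 * (q * g)%:R)) <= y * a / 2.
  rewrite mulrA ler_pdivrMr ?mulr_gt0//.
  have -> : y * a / 2 * (2 * (q * g)%:R) = (q * g)%:R * y * a by field.
  by rewrite ler_pM2r.
lra.
Qed.

(** Just before a jump [n] equals [q * g * S n - 1], and the base 2 exponent of [Z_n] is bounded by
    the constant [c]; division by [n] leaves at most [e] at such levels. *)
Lemma lower_pressure_jump_le0 t : tau2 * d%:R <= t ->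
  (lower_pressure (cube R d) (grid_alphabet d m) (grid_map R d m r) t <= 0)%E.
Proof.
move=> t_ge; have dR : 0 < d%:R :> R by rewrite ltr0n.
have ln2 : 0 < ln (2 : R) by rewrite ln_gt0// ltr1n.
have t0 : 0 <= t by apply: le_trans t_ge; rewrite mulr_ge0// ltW.
apply: limn_einf_le0 => e e0 N.
set c := t * kap + t * bet * s0%:R.
have [n Mn jump] := jump_seq_jumps q g s0 q_gt0 g_gt1 s0_gt0
  (maxn N.+1 (Num.truncn (c * ln 2 / e)).+1).
have Nn : (N < n)%N by apply: leq_trans Mn; exact: leq_maxl.
have cn : c * ln 2 / e <= n%:R.
  apply: ltW; apply: (lt_le_trans (truncnS_gt _)); rewrite ler_nat.
  by apply: leq_trans Mn; exact: leq_maxr.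
(* The pressure sequence starts with [Z_1], so its term [n] concerns level [n.+1]; the jump takes
   place on entering level [n.+2]. *)
case: n Nn jump cn {Mn} => // n Nn jump cn; exists n => //.
rewrite Zn_jumpE elog_pow2 -EFinM lee_fin ler_pdivrMl ?ltr0n//.
rewrite ler_pdivrMr// in cn; apply: le_trans cn.
rewrite ler_pM2r//.
have {jump} : n.+1%:R + 1 = (q * g)%:R * (S n.+1)%:R :> R.
  by rewrite natr1 jump natrM.
have : 0 <= (S n.+1)%:R :> R by [].
move: (n.+1%:R) (S n.+1)%:R => x y y0 xE.
have h1 : y * d%:R <= y * t * (kap * (q * g)%:R + bet).
  rewrite -tau2E -mulrA ler_wpM2l// ler_pdivlMr// mulrC//.
have h2 : 0 <= d%:R * s0%:R :> R by [].
have {}xE : x = (q * g)%:R * y - 1 by lra.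
rewrite xE /c; lra.
Qed.

Lemma Bphi_jump :
  Bphi (cube R d) (grid_alphabet d m) (grid_map R d m r) = (tau2 * d%:R)%:E.
Proof.
apply/eqP; rewrite eq_le; apply/andP; split.
  apply: ge_ereal_sup => _ [t [t0 Pt] <-]; rewrite lee_fin leNgt.
  by apply/negP => /ltW/lower_pressure_jump_le0; rewrite leNgt Pt.
apply/lee_addgt0Pr => e e0.
have dR : 0 < d%:R :> R by rewrite ltr0n.
(* The maximum keeps [t] nonnegative when [e] exceeds [tau2 * d]. *)
pose t := Num.max 0 (tau2 * d%:R - e).
apply: (@le_trans _ _ (t%:E + e%:E)%E).
  by rewrite -EFinD lee_fin -lerBlDr le_max lexx orbT.
rewrite leeD2r//; apply: le_ereal_sup_tmp; exists t%:E => //.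
have t0 : 0 <= t by rewrite le_max lexx.
exists t => //; split => //; apply: lower_pressure_jump_gt0 => //.
by rewrite gt_max mulr_gt0// gtrBl.
Qed.

End Pressure.

End JumpSystem.

(** * Choice of the parameters *)

Theorem theorem6p1 (R : realType) (d : nat) (t1 t2 eps : R) :
  0 < t1 -> t1 < t2 -> t2 < d%:R -> 0 < eps ->
  exists (X : set 'rV[R]_d) (I : nat -> set nat)
         (phi : nat -> nat -> 'rV[R]_d -> 'rV[R]_d),
    [/\ admissible_X X, NCIFS X I phi, perfectly_balanced X I phi,
        (limn_esup (fun j => ((j.+1%:R)^-1)%:E * elog (ecard (I j))) <= eps%:E)%E &
        (HD (limit_set X I phi) = t1%:E /\ Bphi X I phi = t2%:E)].
Proof.
move=> t1_gt0 t12 t2d eps_gt0.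
have t2_gt0 : 0 < t2 by exact: lt_trans t12.
have dR : 0 < d%:R :> R by exact: lt_trans t2d.
have d_gt0 : (0 < d)%N by rewrite ltr0n in dR.
pose tau1 := t1 / d%:R; pose tau2 := t2 / d%:R.
have tau1_gt0 : 0 < tau1 by rewrite divr_gt0.
have tau2_gt0 : 0 < tau2 by rewrite divr_gt0.
have tau12 : tau1 < tau2 by rewrite ltr_pM2r// invr_gt0.
have tau2_lt1 : tau2 < 1 by rewrite ltr_pdivrMr// mul1r.
(* Subtracting the two dimension formulas gives [theta = (bet - 1) * (g - 1)], which fixes [bet]
   once [g = k.+1] is chosen. *)
pose theta := tau1^-1 - tau2^-1.
have theta_gt0 : 0 < theta by rewrite subr_gt0 ltf_pV2.
pose u := tau2^-1 - 1.
have u_gt0 : 0 < u by rewrite subr_gt0 invf_gt1.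
(* A large [k] brings [bet] below [tau2^-1], so that [kap] is positive. *)
pose k := (Num.truncn (theta / u)).+1.
have kR : 0 < k%:R :> R by rewrite ltr0n.
have k_large : theta / k%:R < u.
  by rewrite ltr_pdivrMr// mulrC -ltr_pdivrMr// truncnS_gt.
pose g := k.+1; pose bet := 1 + theta / k%:R.
(* Only the product [kap * q * g] enters the two formulas, so [q] is free to control the alphabets;
   [s0] below makes [theta * s0 >= 1], as [jump_room] demands. *)
pose q := (Num.truncn (d%:R * ln 2 / eps)).+1.
pose kap := (tau2^-1 - bet) / (q * g)%:R.
pose s0 := (Num.truncn theta^-1).+1.
have [q_gt0 g_gt1 s0_gt0] : [/\ (0 < q)%N, (1 < g)%N & (0 < s0)%N] by [].
have qgR : 0 < (q * g)%:R :> R by rewrite ltr0n muln_gt0.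
have kap_gt0 : 0 < kap.
  by rewrite divr_gt0//; move: k_large; rewrite /u /bet; lra.
have bet_ge1 : 1 <= bet by rewrite lerDl divr_ge0// ltW.
have tau2E : tau2^-1 = kap * (q * g)%:R + bet by rewrite divfK ?gt_eqF// subrK.
have tau1E : tau1^-1 = kap * (q * g)%:R + (bet - 1) * g%:R + 1.
  have theta_k : theta / k%:R * k%:R = theta by rewrite divfK ?gt_eqF.
  have -> : kap * (q * g)%:R = tau2^-1 - bet by rewrite divfK ?gt_eqF.
  have -> : g%:R = k%:R + 1 :> R by rewrite natr1.
  by move: theta_k; rewrite /bet /theta; lra.
have room : 1 <= (bet - 1) * ((g - 1) * s0)%:R.
  rewrite /bet subn1 /= natrM [1 + _]addrC addrK mulrA divfK ?gt_eqF//.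
  by rewrite mulrC -ler_pdivrMr// mul1r ltW// truncnS_gt.
have tau1_le1 : tau1 <= 1 by exact: ltW (lt_trans tau12 tau2_lt1).
pose m := jump_branching q g s0; pose r := jump_ratio R q g s0 kap bet.
exists (cube R d), (grid_alphabet d m), (grid_map R d m r); split.
- exact: cube_admissible.
- by apply: jump_NCIFS.
- exact: grid_perfectly_balanced (jump_ratio_gt0 _ _ _ _ _ _).
- apply: jump_growth => //.
  by rewrite [leRHS]mulrC -ler_pdivrMr// ltW// truncnS_gt.
- have tauK (t : R) : t / d%:R * d%:R = t by rewrite divfK ?gt_eqF.
  split.
    by rewrite (HD_jump R d q g s0 kap bet d_gt0 q_gt0 g_gt1 s0_gt0 kap_gt0 bet_ge1
      room tau1)// tauK.
  by rewrite (Bphi_jump R d q g s0 kap bet d_gt0 q_gt0 g_gt1 s0_gt0 kap_gt0 bet_ge1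
      room tau2)// tauK.
Qed.
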